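(* Let $R$ be a non-zero commutative noetherian ring with identity. Let $A$ be a non-zero finitely generated $R$-module that is totally $A$-reflexive and not semidualizing. Then there are commutative noetherian rings $R_1,R_2\neq 0$ with identity such that $R\cong R_1\times R_2$, and there is a semidualizing $R_1$-module $A_1$ such that $A\cong A_1\times 0$. In particular, $\operatorname{Spec}(R)$ is disconnected.
   Context: All modules are unital. For a commutative noetherian ring $S$, a finitely generated $S$-module $C$ is semidualizing if the natural homothety map $\chi^S_C\colon S\to\operatorname{Hom}_S(C,C)$ is an isomorphism and $\operatorname{Ext}^i_S(C,C)=0$ for all $i\geq 1$. For a finitely generated $R$-module $A$, a finitely generated $R$-module $N$ is totally $A$-reflexive if the natural biduality map $N\to\operatorname{Hom}_R(\operatorname{Hom}_R(N,A),A)$ is an isomorphism and $\operatorname{Ext}^i_R(N,A)=0=\operatorname{Ext}^i_R(\operatorname{Hom}_R(N,A),A)$ for all $i\geq 1$; ''$A$ is totally $A$-reflexive'' is the case $N=A$. Given $R\cong R_1\times R_2$, the module $A_1\times 0$ is regarded as an $R$-module via this isomorphism, with $R_1\times R_2$ acting componentwise. *)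

(* Defs.v *)
(* MathComp-Analysis supplies the classical axioms and the topology of Spec. *)
From HB Require Import structures.
From mathcomp Require Import all_boot all_algebra.
From mathcomp Require Import boolp classical_sets topology.

Set Implicit Arguments.
Unset Strict Implicit.
Unset Printing Implicit Defensive.
Import GRing.Theory.
Local Open Scope ring_scope.
Local Open Scope classical_set_scope.

Section FinGen.
Variable R : comPzRingType.

Definition fin_gen (M : lmodType R) : Prop :=
  exists (n : nat) (g : 'I_n -> M),
    forall x, exists c : 'I_n -> R, x = \sum_(i < n) c i *: g i.

(* An ideal of R is a submodule of the regular module R^o.  Under the classical
   axioms every subset of R is a boolean predicate. *)
Definition noetherian : Prop :=
  forall I : {pred R^o}, submod_closed I ->
    exists (n : nat) (g : 'I_n -> R),
      (forall i, g i \in I) /\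
      forall x, x \in I -> exists c : 'I_n -> R, x = \sum_(i < n) c i * g i.

End FinGen.
Arguments noetherian R : clear implicits.

Section LinearExt.
Variables (R : pzRingType) (M N : lmodType R).

Lemma linear_ext (f g : {linear M -> N}) : (forall x, f x = g x) -> f = g.
Proof.
case: f g => [f [[f1] [f2]]] [g [[g1] [g2]]] /= fg.
have {}fg : f = g by apply/funext.
move: f1 f2 g1 g2; rewrite fg => *.
by congr (GRing.Linear.Pack (GRing.Linear.Class _ _)); congr (_ _);
  apply: Prop_irrelevance.
Qed.

End LinearExt.

Section HomModule.
Variables (R : comPzRingType) (M N : lmodType R).
Implicit Types f g : {linear M -> N}.

Definition hom0_fun (_ : M) : N := 0.
Definition homD_fun f g (x : M) : N := f x + g x.
Definition homN_fun f (x : M) : N := - f x.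
Definition homZ_fun (a : R) f (x : M) : N := a *: f x.

Fact hom0_linear : linear hom0_fun.
Proof. by move=> a x y; rewrite /hom0_fun scaler0 addr0. Qed.
Fact homD_linear f g : linear (homD_fun f g).
Proof.
by move=> a x y; rewrite /homD_fun !linearP scalerDr addrACA.
Qed.
Fact homN_linear f : linear (homN_fun f).
Proof. by move=> a x y; rewrite /homN_fun linearP opprD scalerN. Qed.
Fact homZ_linear a f : linear (homZ_fun a f).
Proof.
by move=> b x y; rewrite /homZ_fun linearP scalerDr !scalerA mulrC.
Qed.

HB.instance Definition _ :=
  GRing.isLinear.Build R M N *:%R hom0_fun hom0_linear.
HB.instance Definition _ f g :=
  GRing.isLinear.Build R M N *:%R (homD_fun f g) (homD_linear f g).
HB.instance Definition _ f :=
  GRing.isLinear.Build R M N *:%R (homN_fun f) (homN_linear f).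
HB.instance Definition _ a f :=
  GRing.isLinear.Build R M N *:%R (homZ_fun a f) (homZ_linear a f).

Definition hom0 : {linear M -> N} := hom0_fun.
Definition homD f g : {linear M -> N} := homD_fun f g.
Definition homN f : {linear M -> N} := homN_fun f.
Definition homZ a f : {linear M -> N} := homZ_fun a f.

Fact homDA : associative homD.
Proof. by move=> f g h; apply: linear_ext => x; exact: addrA. Qed.
Fact homDC : commutative homD.
Proof. by move=> f g; apply: linear_ext => x; exact: addrC. Qed.
Fact hom0D : left_id hom0 homD.
Proof. by move=> f; apply: linear_ext => x; exact: add0r. Qed.
Fact homND : left_inverse hom0 homN homD.
Proof. by move=> f; apply: linear_ext => x; exact: addNr. Qed.

HB.instance Definition _ := gen_eqMixin {linear M -> N}.
HB.instance Definition _ := gen_choiceMixin {linear M -> N}.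
HB.instance Definition _ :=
  GRing.isZmodule.Build {linear M -> N} homDA homDC hom0D homND.

Fact homZA a b f : homZ a (homZ b f) = homZ (a * b) f.
Proof. by apply: linear_ext => x; exact: scalerA. Qed.
Fact hom1Z : left_id 1 homZ.
Proof. by move=> f; apply: linear_ext => x; exact: scale1r. Qed.
Fact homZDr : right_distributive homZ +%R.
Proof. by move=> a f g; apply: linear_ext => x; exact: scalerDr. Qed.
Fact homZDl f : {morph homZ^~ f : a b / a + b}.
Proof. by move=> a b; apply: linear_ext => x; exact: scalerDl. Qed.

HB.instance Definition _ := GRing.Zmodule_isLmodule.Build R {linear M -> N}
  homZA hom1Z homZDr homZDl.

End HomModule.

Section NaturalMaps.
Variable R : comPzRingType.

Definition homothety (C : lmodType R) (a : R^o) : {linear C -> C} :=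
  ( *:%R (a : R) : C -> C).

Fact homothety_linear (C : lmodType R) : linear (@homothety C).
Proof.
by move=> a b c; apply: linear_ext => x; rewrite /= scalerDl -scalerA.
Qed.
HB.instance Definition _ (C : lmodType R) :=
  GRing.isLinear.Build R R^o {linear C -> C} *:%R
    (@homothety C) (@homothety_linear C).

Definition eval_at (N A : lmodType R) (x : N) (f : {linear N -> A}) : A := f x.

Fact eval_at_linear (N A : lmodType R) (x : N) : linear (@eval_at N A x).
Proof. by []. Qed.
HB.instance Definition _ (N A : lmodType R) (x : N) :=
  GRing.isLinear.Build R {linear N -> A} A *:%R
    (@eval_at N A x) (@eval_at_linear N A x).

Definition biduality (N A : lmodType R) (x : N) :
  {linear {linear N -> A} -> A} := @eval_at N A x.

Fact biduality_linear (N A : lmodType R) : linear (@biduality N A).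
Proof. by move=> a x y; apply: linear_ext => f; exact: linearP. Qed.
HB.instance Definition _ (N A : lmodType R) :=
  GRing.isLinear.Build R N {linear {linear N -> A} -> A} *:%R
    (@biduality N A) (@biduality_linear N A).

End NaturalMaps.

Section Ext.
Variable R : comPzRingType.

Definition projective (P : lmodType R) : Prop :=
  forall (M N : lmodType R) (p : {linear M -> N}) (f : {linear P -> N}),
    (forall y, exists x, p x = y) ->
    exists g : {linear P -> M}, forall x, p (g x) = f x.

Record proj_resolution (M : lmodType R) := ProjResolution {
  res_obj :> nat -> lmodType R;
  res_diff : forall n, {linear res_obj n.+1 -> res_obj n};
  res_aug : {linear res_obj 0%N -> M};
  res_proj : forall n, projective (res_obj n);
  res_aug_surj : forall y, exists x, res_aug x = y;
  res_exact0 : forall x, res_aug x = 0 <-> exists y, res_diff 0%N y = x;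
  res_exactS : forall n x,
    res_diff n x = 0 <-> exists y, res_diff n.+1 y = x
}.

Section Cochains.
Variables (M : lmodType R) (P : proj_resolution M) (N : lmodType R).

Definition cocycle (i : nat) (f : {linear P i -> N}) : Prop :=
  forall x, f (res_diff P i x) = 0.

Definition coboundary (i : nat) : {linear P i -> N} -> Prop :=
  match i return {linear P i -> N} -> Prop with
  | 0%N => fun f => forall x, f x = 0
  | j.+1 => fun f => exists g : {linear P j -> N},
                       forall x, f x = g (res_diff P j x)
  end.

End Cochains.

(* Ext^i_R(M, N) = H^i(Hom_R(P, N)) does not depend on the projective
   resolution P of M; its vanishing is required for every P. *)
Definition Ext_vanishes (i : nat) (M N : lmodType R) : Prop :=
  forall (P : proj_resolution M) (f : {linear P i -> N}),
    cocycle f -> coboundary f.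

End Ext.

Section Reflexivity.
Variable R : comPzRingType.

Definition semidualizing (C : lmodType R) : Prop :=
  [/\ fin_gen C,
      bijective (@homothety R C)
    & forall i, (1 <= i)%N -> Ext_vanishes i C C].

Definition totally_reflexive (A N : lmodType R) : Prop :=
  [/\ fin_gen N,
      bijective (@biduality R N A)
    & forall i, (1 <= i)%N ->
        Ext_vanishes i N A /\ Ext_vanishes i {linear N -> A} A].

Definition lmod_iso (M N : lmodType R) : Prop :=
  exists f : {linear M -> N}, bijective f.

End Reflexivity.

(* phi occurs only as a key for the R-module structure. *)
Definition restrict_scalars (R S : comPzRingType) (phi : {rmorphism R -> S})
  (M : lmodType S) : Type := M.

Section RestrictScalars.
Variables (R S : comPzRingType) (phi : {rmorphism R -> S}) (M : lmodType S).

HB.instance Definition _ := GRing.Zmodule.on (restrict_scalars phi M).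

Definition restrict_scale (a : R) (x : restrict_scalars phi M) :
  restrict_scalars phi M := phi a *: (x : M).

Fact restrict_scaleA a b x :
  restrict_scale a (restrict_scale b x) = restrict_scale (a * b) x.
Proof. by rewrite /restrict_scale scalerA rmorphM. Qed.
Fact restrict_scale1 : left_id 1 restrict_scale.
Proof. by move=> x; rewrite /restrict_scale rmorph1 scale1r. Qed.
Fact restrict_scaleDr : right_distributive restrict_scale +%R.
Proof. by move=> a x y; exact: scalerDr. Qed.
Fact restrict_scaleDl x : {morph restrict_scale^~ x : a b / a + b}.
Proof. by move=> a b; rewrite /restrict_scale rmorphD scalerDl. Qed.
HB.instance Definition _ := GRing.Zmodule_isLmodule.Build R
  (restrict_scalars phi M) restrict_scaleA restrict_scale1 restrict_scaleDr restrict_scaleDl.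

End RestrictScalars.

Section ProdModule.
Variables (R1 R2 : comPzRingType) (M1 : lmodType R1) (M2 : lmodType R2).

(* An alias: M1 * M2 carries library module structures only over a common
   ring of scalars. *)
Definition prod_module : Type := (M1 * M2)%type.
HB.instance Definition _ := GRing.Zmodule.on prod_module.

Definition prod_scale (a : R1 * R2) (x : prod_module) : prod_module :=
  (a.1 *: x.1, a.2 *: x.2).

Fact prod_scaleA a b x : prod_scale a (prod_scale b x) = prod_scale (a * b) x.
Proof. by rewrite /prod_scale /= !scalerA. Qed.
Fact prod_scale1 : left_id 1 prod_scale.
Proof. by case=> x y; rewrite /prod_scale /= !scale1r. Qed.
Fact prod_scaleDr : right_distributive prod_scale +%R.
Proof. by move=> a x y; rewrite /prod_scale /= !scalerDr. Qed.
Fact prod_scaleDl x : {morph prod_scale^~ x : a b / a + b}.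
Proof. by move=> a b; rewrite /prod_scale /= !scalerDl. Qed.
HB.instance Definition _ :=
  GRing.Zmodule_isLmodule.Build (R1 * R2)%type prod_module
    prod_scaleA prod_scale1 prod_scaleDr prod_scaleDl.

End ProdModule.

(* idealr_closed requires the ideal to be proper. *)
Record Spec (R : comNzRingType) := PrimeIdeal {
  prime_pred : {pred R};
  prime_ideal : idealr_closed prime_pred;
  prime_prime : prime_idealr_closed prime_pred
}.

Section Zariski.
Variable R : comNzRingType.

HB.instance Definition _ := gen_eqMixin (Spec R).
HB.instance Definition _ := gen_choiceMixin (Spec R).

Definition zero_locus (E : set R) : set (Spec R) :=
  [set p | forall f, E f -> f \in prime_pred p].

Definition zariski_open : set (set (Spec R)) :=
  [set U | exists E : set R, U = ~` zero_locus E].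

Fact zariski_openT : zariski_open setT.
Proof.
exists setT; apply/seteqP; split=> // p _ pT.
by have [_ /negP p1 _] := prime_ideal p; apply: p1; exact: pT.
Qed.

Fact zariski_openI : setI_closed zariski_open.
Proof.
move=> _ _ [E ->] [F ->].
exists [set h | exists f g, [/\ E f, F g & h = f * g]].
rewrite -setCU; congr (~` _); apply/seteqP; split=> [p|p pEF].
  have [_ _ pP] := prime_ideal p.
  have pM a u : u \in prime_pred p -> a * u \in prime_pred p.
    have [p0 _ _] := prime_ideal p.
    by move=> pu; rewrite -[_ * _]addr0 pP.
  case=> pE _ [f [g [Ef Fg ->]]]; last exact/pM/pE.
  by rewrite mulrC; exact/pM/pE.
have [pE|/existsNP[f /not_implyP[Ef pf]]] := pselect (zero_locus E p).
  by left.
right=> g Fg; have : f * g \in prime_pred p by apply: pEF; exists f, g.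
by move=> /(prime_prime (s := p)) /orP[].
Qed.

Fact zariski_open_bigU (I : Type) (U : I -> set (Spec R)) :
  (forall i, zariski_open (U i)) -> zariski_open (\bigcup_i U i).
Proof.
move=> /choice[E UE]; exists (\bigcup_i E i).
apply/seteqP; split=> [p [i _]|p].
  by rewrite UE => pE pEE; apply: pE => f Ef; apply: pEE; exists i.
move=> /existsNP[f /not_implyP[[i _ Ef] pf]].
by exists i => //; rewrite UE => /(_ f Ef).
Qed.

HB.instance Definition _ := isOpenTopological.Build (Spec R)
  zariski_openT zariski_openI zariski_open_bigU.

End Zariski.

(* Main.v *)
Require Import Defs.
From HB Require Import structures.
From mathcomp Require Import all_boot all_algebra.
From mathcomp Require Import boolp classical_sets topology.

(** Write E = Hom(A, A), I = Ann(A), and let X be the mapping cone of the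
    homothety map R -> E, so that its homology is C = E / (R id) and I.  The
    composite A -> Hom(E, A) -> Hom(R, A) = A of the biduality map and of
    restriction along the homothety map is the identity; as the biduality map
    is bijective and Ext^i(E, A) = 0 for i >= 1, the complex RHom(X, A) is
    acyclic.  The modules N with RHom(X, N) = 0, here [cone_orthogonal], are
    closed under finite products and under cokernels of injections.  The proof
    extracts the support-theoretic content of this acyclicity without
    localizing.

    Two facts drive it.  First ([ideal_mul_full]), suppose that some ideal J
    kills no nonzero element of any orthogonal module.  The Koszul complex on
    generators of J, with coefficients in A, has orthogonal terms and cohomology
    killed by J.  Going up degree by degree, each cokernel of a differential is
    again orthogonal, so the cohomology vanishes in every degree, the last one
    included, where it is A / J A.  Thus J A = A, and Nakayama's lemma gives an
    element a of J that acts as the identity on A ([ideal_unit]).  Secondly, by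
    McCoy's theorem on solutions of linear systems with coefficients in a module
    ([mccoy]), if Ann(G) kills a nonzero element of N, with G finitely
    generated, then there is a nonzero linear map from G to N.

    For G = C: orthogonality includes Hom(C, N) = 0, so the first fact applies
    to J = Ann(C), and the resulting a satisfies h = a h for h in E and
    a E <= R id; the homothety map is onto ([homothety_surj]).  Then E = R / I,
    and orthogonality becomes I N = 0 and Ext^1(R / I, N) = 0, which force
    Hom(I, N) = 0 ([ann_orthogonal]).  For G = I, the first fact with J = Ann(I)
    gives a in Ann(I) with 1 - a in I, so I is generated by the idempotent
    f = 1 - a ([ann_idempotent]).

    With e = 1 - f, the ring R is the product of the corner rings e R and f R,
    and A is an e R-module on which e R acts faithfully with all endomorphisms
    homotheties.  Ext over e R is computed from resolutions that remain
    projective over R, so it vanishes too ([semidualizing_corner]).  Both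
    factors are nonzero: e acts as the identity on A, and f = 0 would make A
    semidualizing over R.  The clopen sets V(e) and V(f) then disconnect
    Spec(R). *)

Set Implicit Arguments.
Unset Strict Implicit.
Unset Printing Implicit Defensive.
Import GRing.Theory.
Local Open Scope ring_scope.
Local Open Scope classical_set_scope.

(** * Constructing linear maps *)

Section LinearMaps.
Variable R : comPzRingType.

Definition mk_linear (M N : lmodType R) (f : M -> N) (lf : linear f) :
  {linear M -> N} :=
  HB.pack_for {linear M -> N} f (GRing.isLinear.Build R M N *:%R f lf).

(** A total relation that is a submodule of the product and meets the second
    axis only in zero is the graph of a linear map.  Maps that depend on the
    choice of a preimage or of coefficients are obtained in this way. *)
Lemma linear_of_rel (M N : lmodType R) (Q : M -> N -> Prop) :
    (forall x, exists y, Q x y) ->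
    (forall y, Q 0 y -> y = 0) ->
    (forall a x y x' y', Q x y -> Q x' y' -> Q (a *: x + x') (a *: y + y')) ->
  exists h : {linear M -> N}, forall x, Q x (h x).
Proof.
move=> /choice[h Qh] Q0 QL.
have hE x y : Q x y -> h x = y.
  move=> Qxy; apply/eqP; rewrite -subr_eq0 addrC -scaleN1r; apply/eqP/Q0.
  by rewrite -(addNr x) -(scaleN1r x); apply: QL.
have lh : linear h by move=> a x y; apply: hE; apply: QL.
by exists (mk_linear lh).
Qed.

Lemma factor_through_surj (M L N : lmodType R) (p : {linear M -> L})
    (f : {linear M -> N}) :
    (forall y, exists x, p x = y) -> (forall x, p x = 0 -> f x = 0) ->
  exists h : {linear L -> N}, forall x, h (p x) = f x.
Proof.
move=> p_surj ker_pf.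
have [y|y [x [px <-]]|a y z y' z' [x [<- <-]] [x' [<- <-]]|h hP] :=
  @linear_of_rel L N (fun y z => exists x, p x = y /\ f x = z).
- by have [x px] := p_surj y; exists (f x), x.
- exact: ker_pf.
- by exists (a *: x + x'); rewrite !linearP.
exists h => x; have [x' [px' <-]] := hP (p x).
apply/eqP; rewrite -subr_eq0 -linearB; apply/eqP/ker_pf.
by rewrite linearB px' subrr.
Qed.

Lemma factor_through_inj (M L N : lmodType R) (i : {linear L -> N})
    (f : {linear M -> N}) :
    (forall y, i y = 0 -> y = 0) -> (forall x, exists y, i y = f x) ->
  exists h : {linear M -> L}, forall x, i (h x) = f x.
Proof.
move=> i_inj f_im; apply: (@linear_of_rel M L (fun x y => i y = f x)) => //.
  by move=> y; rewrite linear0; exact: i_inj.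
by move=> a x y x' y' fx fx'; rewrite !linearP fx fx'.
Qed.

Definition span_fun (M : lmodType R) n (g : 'I_n -> M) (c : 'rV[R]_n) : M :=
  \sum_i c 0 i *: g i.

Fact span_linear (M : lmodType R) n (g : 'I_n -> M) : linear (span_fun g).
Proof.
move=> a c d; rewrite /span_fun scaler_sumr -big_split /=.
by apply: eq_bigr => i _; rewrite !mxE scalerDl scalerA.
Qed.
HB.instance Definition _ (M : lmodType R) n (g : 'I_n -> M) :=
  GRing.isLinear.Build R 'rV[R]_n M *:%R (span_fun g) (@span_linear M n g).

Definition span_map (M : lmodType R) n (g : 'I_n -> M) :
  {linear 'rV[R]_n -> M} := span_fun g.

Lemma span_delta (M : lmodType R) n (g : 'I_n -> M) i :
  span_map g (delta_mx 0 i) = g i.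
Proof.
rewrite /span_map /= /span_fun (bigD1 i) //= mxE !eqxx scale1r big1 ?addr0 //.
by move=> j /negPf ji; rewrite mxE ji andbF scale0r.
Qed.

Lemma free_projective n : projective 'rV[R]_n.
Proof.
move=> M N p f p_surj.
have /choice[g gP] : forall i, exists m, p m = f (delta_mx 0 i) by [].
exists (span_map g) => x; rewrite {2}(row_sum_delta x) !linear_sum /=.
by apply: eq_bigr => i _; rewrite !linearZ /= gP.
Qed.

Lemma fin_genP (M : lmodType R) : fin_gen M <->
  exists (n : nat) (g : 'I_n -> M), forall x, exists c, span_map g c = x.
Proof.
split=> -[n [g gP]]; exists n, g => x; have [c cP] := gP x.
  exists (\row_i c i); rewrite cP /span_map /= /span_fun.
  by apply: eq_bigr => i _; rewrite mxE.
by exists (fun i => c 0 i); rewrite -cP.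
Qed.

End LinearMaps.

(** * Submodules of finitely generated modules *)

Section Noetherian.
Variable R : comPzRingType.

Definition is_submod (M : lmodType R) (S : set M) :=
  S 0 /\ forall a x y, S x -> S y -> S (a *: x + y).

Definition fg_submod (M : lmodType R) (S : set M) :=
  exists (n : nat) (g : 'I_n -> M),
    (forall i, S (g i)) /\ forall x, S x -> exists c, span_map g c = x.

Definition noetherian_module (M : lmodType R) :=
  forall S : set M, is_submod S -> fg_submod S.

Lemma is_submod_sum (M : lmodType R) (S : set M) n (c : 'I_n -> R)
    (g : 'I_n -> M) : is_submod S -> (forall i, S (g i)) ->
  S (\sum_i c i *: g i).
Proof.
move=> [S0 SL] Sg; elim/big_ind: _ => // [x y Sx Sy|i _].
  by rewrite -[x]scale1r; apply: SL.
by rewrite -[_ *: _]addr0; apply: SL.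
Qed.

Lemma noetherian_regular : noetherian R -> noetherian_module R^o.
Proof.
move=> R_noeth S [S0 SL].
have [|n [g [Sg gP]]] := R_noeth (fun x => `[< S x >]).
  by split=> [|a x y /asboolP Sx /asboolP Sy]; apply/asboolP => //; apply: SL.
exists n, g; split=> [i|x Sx]; first exact/asboolP/Sg.
have [|c ->] := gP x; first exact/asboolP.
by exists (\row_i c i); apply: eq_bigr => i _; rewrite mxE.
Qed.

(** Generators of the kernel of p on S, together with lifts of generators of
    its image, generate S. *)
Lemma fg_submod_ker (G N : lmodType R) (p : {linear G -> N}) (S : set G) :
    noetherian_module N -> is_submod S ->
  fg_submod (S `&` [set x | p x = 0]) -> fg_submod S.
Proof.
move=> N_noeth [S0 SL] [k [h [Sh hP]]].
have [|n [y [/choice[x xP] yP]]] := N_noeth [set y | exists x, S x /\ p x = y].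
  split=> [|a _ _ [x [Sx <-]] [x' [Sx' <-]]].
    by exists 0; rewrite linear0.
  by exists (a *: x + x'); rewrite linearP; split=> //; apply: SL.
exists (n + k)%N, (fun i => match split i with inl j => x j | inr j => h j end).
split=> [i|z Sz].
  by case: split => j; [have [] := xP j | have [] := Sh j].
have [|c cP] := yP (p z); first by exists z.
pose w := \sum_i c 0 i *: x i.
have Sw : S w by apply: is_submod_sum => // i; have [] := xP i.
have [|d dP] := hP (z - w).
  split; first by rewrite addrC -scaleN1r; apply: SL.
  rewrite /= linearB -cP linear_sum; apply/eqP; rewrite subr_eq0; apply/eqP.
  by apply: eq_bigr => i _; rewrite linearZ /=; have [_ ->] := xP i.
exists (row_mx c d); rewrite /span_map /= /span_fun big_split_ord /=.
rewrite -[RHS](subrK w) addrC; congr (_ + _); rewrite -?dP.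
  all: apply: eq_bigr => i _.
  by rewrite row_mxEr -/(unsplit (inr i)) unsplitK.
by rewrite row_mxEl -/(unsplit (inl i)) unsplitK.
Qed.

(** A submodule of a finite power of a noetherian module, presented by its
    coordinate maps so that no power has to be formed. *)
Lemma fg_submod_coords (G N : lmodType R) n (u : 'I_n -> {linear G -> N})
    (S : set G) : noetherian_module N -> is_submod S ->
    (forall x, S x -> (forall i, u i x = 0) -> x = 0) -> fg_submod S.
Proof.
move=> N_noeth; elim: n u S => [|n IHn] u S SS u_inj.
  exists 0%N, (fun=> 0); split=> [[]//|x Sx].
  by exists 0; rewrite linear0 (u_inj x) // => -[].
apply: (@fg_submod_ker _ _ (u ord0)) => //.
apply: (IHn (fun i => u (lift ord0 i))) => [|x [Sx ux0] ux].
  have [S0 SL] := SS; split=> [|a x y [Sx /= ux] [Sy /= uy]].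
    by split=> //=; rewrite linear0.
  by split=> /=; [apply: SL | rewrite linearP ux uy scaler0 addr0].
by apply: u_inj => // i; case: (unliftP ord0 i) => [j ->|->].
Qed.

Lemma noetherian_fin_gen (M : lmodType R) :
  noetherian R -> fin_gen M -> noetherian_module M.
Proof.
move=> /noetherian_regular R_noeth /fin_genP[n [g gP]] S [S0 SL].
have coord_linear i : linear (fun c : 'rV[R]_n => c 0 i : R^o).
  by move=> a c d; rewrite !mxE.
have [|c Sc c0|k [t [St tP]]] :=
  @fg_submod_coords _ _ _ (fun i => mk_linear (coord_linear i))
    [set c | S (span_map g c)] R_noeth.
- split=> [|a c d Sc Sd]; first by rewrite /= linear0.
  by rewrite /= linearP; apply: SL.
- by apply/rowP => i; rewrite [LHS]c0 mxE.
exists k, (fun i => span_map g (t i)); split=> // x.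
have [c <- Sc] := gP x; have [d <-] := tP c Sc.
exists d; rewrite {2}/span_map /= {2}/span_fun linear_sum.
by apply: eq_bigr => i _; rewrite linearZ.
Qed.

Lemma fin_gen_hom (M N : lmodType R) :
  noetherian R -> fin_gen M -> fin_gen N -> fin_gen {linear M -> N}.
Proof.
move=> R_noeth /fin_genP[n [g gP]] /(noetherian_fin_gen R_noeth) N_noeth.
have eval_linear i : linear (fun f : {linear M -> N} => f (g i)) by [].
have [|f _ f0|k [t [_ tP]]] :=
  @fg_submod_coords _ _ _ (fun i => mk_linear (eval_linear i)) setT N_noeth.
- by split.
- apply: linear_ext => x; have [c <-] := gP x.
  rewrite linear_sum big1 // => i _; rewrite linearZ /=.
  by have /= -> := f0 i; rewrite scaler0.
by apply/fin_genP; exists k, t => x; apply: tP.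
Qed.

End Noetherian.

(** * Resolutions by free modules of finite rank *)

Section FreeResolution.
Variable R : comPzRingType.
Hypothesis R_noeth : noetherian R.

Lemma ker_cover (M : lmodType R) n (f : {linear 'rV[R]_n -> M}) :
  exists k (g : {linear 'rV[R]_k -> 'rV[R]_n}),
    forall x, f x = 0 <-> exists y, g y = x.
Proof.
have rVn_fin : fin_gen 'rV[R]_n.
  apply/fin_genP; exists n, (delta_mx 0) => x; exists x.
  exact/esym/row_sum_delta.
have [|k [g [fg gP]]] :=
  noetherian_fin_gen R_noeth rVn_fin (S := [set x | f x = 0]).
  split=> [|a x y /= fx fy]; first by rewrite /= linear0.
  by rewrite linearP fx fy scaler0 addr0.
exists k, (span_map g) => x; split=> [/gP//|[c <-]].
by rewrite linear_sum big1 // => i _; rewrite linearZ /= fg scaler0.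
Qed.

Definition free_map :=
  {k0 : nat & {k1 : nat & {linear 'rV[R]_k1 -> 'rV[R]_k0}}}.

(** Vanishing of Ext is a statement about all projective resolutions; it can
    only be exploited once there is one. *)
Lemma free_resolution (M : lmodType R) :
  fin_gen M -> exists P : proj_resolution M, True.
Proof.
move=> /fin_genP[n [g gP]].
have /cid[k /cid[d0 d0P]] := ker_cover (span_map g).
have step k0 k1 (f : {linear 'rV[R]_k1 -> 'rV[R]_k0}) :
    {k2 : nat & {h : {linear 'rV[R]_k2 -> 'rV[R]_k1} |
       forall x, f x = 0 <-> exists y, h y = x}}.
  by have /cid[k2 /cid[h hP]] := ker_cover f; exists k2, h.
pose next (s : free_map) : free_map :=
  existT _ (projT1 (projT2 s)) (existT _ (projT1 (step _ _ (projT2 (projT2 s))))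
    (proj1_sig (projT2 (step _ _ (projT2 (projT2 s)))))).
pose s i : free_map := iter i next (existT _ n (existT _ k d0)).
unshelve eexists; last by [].
apply: (@ProjResolution R M (fun i => 'rV[R]_(projT1 (s i)))
  (fun i => projT2 (projT2 (s i))) (span_map g)) => //.
- by move=> i; apply: free_projective.
- by move=> i; apply: (proj2_sig (projT2 (step _ _ (projT2 (projT2 (s i)))))).
Qed.

End FreeResolution.

(** * Modules orthogonal to the cone of a map from the ring *)

Section ConeOrthogonal.
Variables (R : comPzRingType) (E : lmodType R) (u : E) (P : proj_resolution E).

(** With X the mapping cone of a |-> a *: u, from R to E, this says that
    RHom(X, M) = 0, that is, that RHom(E, M) -> RHom(R, M) = M is an
    isomorphism. *)
Definition cone_orthogonal (M : lmodType R) :=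
  [/\ forall i (f : {linear P i.+1 -> M}), cocycle f ->
        exists g : {linear P i -> M}, forall x, f x = g (res_diff P i x),
      forall m, exists f : {linear E -> M}, f u = m
    & forall f : {linear E -> M}, f u = 0 -> forall x, f x = 0].

Lemma res_diffK i x : res_diff P i (res_diff P i.+1 x) = 0.
Proof. by apply/res_exactS; exists x. Qed.

Lemma res_augK x : res_aug P (res_diff P 0 x) = 0.
Proof. by apply/res_exact0; exists x. Qed.

Lemma cone_orthogonal0 (M : lmodType R) :
  (forall m : M, m = 0) -> cone_orthogonal M.
Proof.
move=> M0; split=> [i f _|m|f _ x]; last exact: M0.
  by exists (hom0 _ _) => x; rewrite [LHS]M0 [RHS]M0.
by exists (hom0 _ _); rewrite [LHS]M0 [RHS]M0.
Qed.

Lemma cone_orthogonal_prod (M N : lmodType R) :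
  cone_orthogonal M -> cone_orthogonal N -> cone_orthogonal (M * N)%type.
Proof.
move=> [M1 M2 M3] [N1 N2 N3].
have pair_linear (X : lmodType R) (f : {linear X -> M}) (g : {linear X -> N}) :
  linear (fun x => (f x, g x)) by move=> a x y; rewrite !linearP.
split=> [i f f_coc|[m n]|f fu x].
- have [|g gP] := M1 i (fst \o f); first by move=> x; rewrite /= f_coc.
  have [|h hP] := N1 i (snd \o f); first by move=> x; rewrite /= f_coc.
  exists (mk_linear (pair_linear _ g h)) => x.
  by rewrite /= -gP -hP /=; case: (f x).
- have [f fu] := M2 m; have [g gu] := N2 n.
  by exists (mk_linear (pair_linear _ f g)); rewrite /= fu gu.
have /= := M3 (fst \o f); rewrite fu => /(_ erefl x).
have /= := N3 (snd \o f); rewrite fu => /(_ erefl x).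
by case: (f x) => m n /= -> ->.
Qed.

(** RHom(X, -) sends the short exact sequence to an exact triangle with two
    acyclic vertices; concretely, the long exact sequence of Ext(E, -) is
    chased at the level of cochains. *)
Lemma cone_orthogonal_coker (M N L : lmodType R)
    (i : {linear M -> N}) (p : {linear N -> L}) :
    (forall m, i m = 0 -> m = 0) -> (forall l, exists n, p n = l) ->
    (forall n, p n = 0 <-> exists m, i m = n) ->
  cone_orthogonal M -> cone_orthogonal N -> cone_orthogonal L.
Proof.
move=> i_inj p_surj ip_exact [M1 M2 M3] [N1 N2 N3].
have pi0 m : p (i m) = 0 by apply/ip_exact; exists m.
(* a cochain with values in L lifts to N, and its coboundary comes from a
   cocycle with values in M, which bounds *)
have lift_cochain j (f : {linear P j -> L}) :
    (forall x, f (res_diff P j x) = 0) ->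
    exists g : {linear P j -> N}, (forall x, p (g x) = f x) /\
      forall x, g (res_diff P j x) = 0.
  move=> fd0; have [g gP] := @res_proj _ _ P j _ _ p f p_surj.
  have [|h hP] := factor_through_inj (f := g \o res_diff P j) i_inj.
    by move=> x; apply/ip_exact; rewrite /= gP.
  have [|k kP] := M1 j h.
    by move=> x; apply: i_inj; rewrite hP /= res_diffK linear0.
  exists (homD g (homN (i \o k))); split=> x /=.
    all: rewrite /homD_fun /= /homN_fun /=.
    by rewrite linearB gP pi0 subr0.
  by rewrite -kP hP /= subrr.
split=> [j f f_coc|l|f fu x].
- have [g [gP g_coc]] := lift_cochain _ f f_coc.
  by have [h hP] := N1 j g g_coc; exists (p \o h) => x; rewrite -gP hP.
- have [n <-] := p_surj l; have [f fu] := N2 n.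
  by exists (p \o f); rewrite /= fu.
have [|g [gP gd0]] := lift_cochain 0%N (f \o res_aug P).
  by move=> y; rewrite /= res_augK linear0.
have [|g' g'P] :=
  factor_through_surj (p := res_aug P) (f := g) (@res_aug_surj _ _ P).
  by move=> y /res_exact0[z <-].
have pg' y : p (g' y) = f y.
  by have [z <-] := res_aug_surj P y; rewrite g'P gP.
have /ip_exact[m im] : p (g' u) = 0 by rewrite pg'.
have [h hu] := M2 m.
have := N3 (homD g' (homN (i \o h))).
rewrite /= /homD_fun /= /homN_fun /= hu im subrr => /(_ erefl x)/eqP.
by rewrite subr_eq0 -pg' => /eqP ->; rewrite pi0.
Qed.

End ConeOrthogonal.

(** * Quotient modules *)

Section QuotientModule.
Variables (R : comPzRingType) (M : lmodType R) (S : set M).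
Hypothesis S_submod : is_submod S.

Definition submod_pred : {pred M} := fun x => `[< S x >].

Fact submod_pred_zmod : zmod_closed submod_pred.
Proof.
have [S0 SL] := S_submod; split=> [|x y /asboolP Sx /asboolP Sy];
  apply/asboolP => //.
by rewrite addrC -scaleN1r; apply: SL.
Qed.

Definition submod_zmod : zmodClosed M :=
  HB.pack_for (zmodClosed M) submod_pred
    (GRing.isZmodClosed.Build M submod_pred submod_pred_zmod).

Let Q := Quotient.quot submod_zmod.
Local Open Scope quotient_scope.

Let eq_piP (x y : M) : reflect (S (x - y)) (\pi_Q x == \pi_Q y).
Proof.
by rewrite -Quotient.idealrBE; exact: asboolP.
Qed.

Let piD (x y : M) : \pi_Q (x + y) = \pi_Q x + \pi_Q y.
Proof. exact: Quotient.pi_add. Qed.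

Let scaleq (a : R) (x : Q) : Q := \pi_Q (a *: repr x).

Let scaleq_pi a x : scaleq a (\pi_Q x) = \pi_Q (a *: x).
Proof.
apply/eqP/eq_piP; rewrite -scalerBr -[_ *: _]addr0; have [S0 SL] := S_submod.
by apply: SL => //; apply/eq_piP; rewrite reprK.
Qed.

Let scaleqA a b x : scaleq a (scaleq b x) = scaleq (a * b) x.
Proof. by rewrite -[x]reprK (scaleq_pi b) !scaleq_pi scalerA. Qed.
Let scaleq1 : left_id 1 scaleq.
Proof. by move=> x; rewrite -[x]reprK scaleq_pi scale1r. Qed.
Let scaleqDr : right_distributive scaleq +%R.
Proof.
move=> a x y; rewrite -[x]reprK -[y]reprK -piD.
by rewrite !scaleq_pi -piD scalerDr.
Qed.
Let scaleqDl x : {morph scaleq^~ x : a b / a + b}.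
Proof. by move=> a b; rewrite -[x]reprK !scaleq_pi -piD scalerDl. Qed.

Lemma quotient_module : exists (L : lmodType R) (p : {linear M -> L}),
  (forall l, exists x, p x = l) /\ forall x, p x = 0 <-> S x.
Proof.
pose L : lmodType R := HB.pack_for (lmodType R) (Quotient.quot submod_zmod)
  (GRing.Zmodule_isLmodule.Build R Q scaleqA scaleq1 scaleqDr scaleqDl).
have pi_linear : linear (\pi_Q : M -> L).
  by move=> a x y; rewrite [LHS]piD; congr (_ + _); rewrite -scaleq_pi.
exists L, (mk_linear pi_linear); split=> [l|x].
  by exists (repr (l : Q)); apply: reprK.
have := eq_piP x 0; rewrite subr0 raddf0 => Sx.
by split=> [/eqP/Sx//|/Sx/eqP].
Qed.

End QuotientModule.

(** * Koszul complexes *)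

Section Koszul.
Variables (R : comPzRingType) (C : lmodType R -> Prop).
Hypothesis C0 : forall M : lmodType R, (forall m : M, m = 0) -> C M.
Hypothesis C_prod : forall M N : lmodType R, C M -> C N -> C (M * N)%type.
Hypothesis C_coker : forall (M N L : lmodType R)
    (i : {linear M -> N}) (p : {linear N -> L}),
  (forall m, i m = 0 -> m = 0) -> (forall l, exists n, p n = l) ->
  (forall n, p n = 0 <-> exists m, i m = n) -> C M -> C N -> C L.

Record complex := Complex {
  cpx_ob :> nat -> lmodType R;
  cpx_d : forall n, {linear cpx_ob n -> cpx_ob n.+1}
}.

Fixpoint ideal_mul (M : lmodType R) (xs : seq R) : set M :=
  if xs is x :: ys then [set m | exists a b, ideal_mul ys b /\ m = x *: a + b]
  else [set 0].

(** The cohomological Koszul complex of [xs] on [M] has these properties.  It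
    is shifted to start with M in degree 1, after a zero term, so that every
    term that matters has a predecessor; the last nonzero term, in degree
    size xs + 1, is again a copy of M, and the last cohomology module is
    M / xs M. *)
Record koszul_like (xs : seq R) (M : lmodType R) (K : complex) : Prop := {
  koszul_first : forall a : K 0%N, a = 0;
  koszul_dK : forall n (a : K n), cpx_d K n.+1 (cpx_d K n a) = 0;
  koszul_class : forall n, C (K n);
  koszul_homotopy : forall x, x \in xs ->
    exists h : forall n, {linear K n.+1 -> K n}, forall n a,
      cpx_d K n (h n a) + h n.+1 (cpx_d K n.+1 a) = x *: a;
  koszul_last : forall n, ((size xs).+1 < n)%N -> forall a : K n, a = 0;
  koszul_top : exists t : {linear K (size xs).+1 -> M},
    (forall m, exists a, t a = m) /\
    forall a, ideal_mul xs (t (cpx_d K (size xs) a))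
}.

(** The mapping cone of multiplication by [x] on [K], shifted by one. *)
Definition cone_ob (K : complex) n : lmodType R :=
  if n is k.+1 then (K k.+1 * K k)%type : lmodType R else K 0%N.

Fact cone_d_linear (K : complex) (x : R) n :
  linear (fun c : K n.+1 * K n =>
    ((cpx_d K n.+1 c.1, x *: c.1 - cpx_d K n c.2) : K n.+2 * K n.+1)).
Proof.
move=> a [b c] [b' c'] /=; rewrite !linearP; congr (_, _) => /=.
by rewrite scalerDr addrACA.
Qed.

Definition cone_d (K : complex) (x : R) n :
    {linear cone_ob K n -> cone_ob K n.+1} :=
  if n is k.+1 then mk_linear (@cone_d_linear K x k) else hom0 _ _.

Definition cone (K : complex) (x : R) : complex := Complex (cone_d K x).

(** On its own cone, multiplication by [x] is homotopic to zero through the map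
    that moves the second summand to the first. *)
Fact cone_homotopy_new_linear (K : complex) n :
  linear (fun c : K n.+2 * K n.+1 => ((c.2, 0) : K n.+1 * K n)).
Proof.
by move=> a [b c] [b' c'] /=; congr (_, _); rewrite /= scaler0 addr0.
Qed.

Definition cone_homotopy_new (K : complex) n :
    {linear cone_ob K n.+1 -> cone_ob K n} :=
  if n is k.+1 then mk_linear (@cone_homotopy_new_linear K k) else hom0 _ _.

(** A null-homotopy of some other scalar on [K] extends to the cone; the sign
    makes the two terms in [x] cancel. *)
Fact cone_homotopy_old_linear (K : complex)
    (h : forall n, {linear K n.+1 -> K n}) n :
  linear (fun c : K n.+2 * K n.+1 => ((h n.+1 c.1, - h n c.2) : K n.+1 * K n)).
Proof. by move=> a [b c] [b' c'] /=; rewrite !linearP. Qed.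

Definition cone_homotopy_old (K : complex)
    (h : forall n, {linear K n.+1 -> K n}) n :
    {linear cone_ob K n.+1 -> cone_ob K n} :=
  if n is k.+1 then mk_linear (@cone_homotopy_old_linear K h k) else hom0 _ _.

Lemma koszul_like_cone x xs (M : lmodType R) (K : complex) :
  koszul_like xs M K -> koszul_like (x :: xs) M (cone K x).
Proof.
case=> K0 dK CK hK K_last [t [t_surj td]].
split=> //.
- case=> [a|n [a b]]; first exact: (linear0 (cone_d K x 1)).
  congr (_, _); rewrite /= ?dK //.
  by rewrite linearB dK subr0 linearZ /= subrr.
- by case=> [|n] /=; [exact: CK | apply: C_prod; apply: CK].
- move=> y; rewrite in_cons => /predU1P[->|/hK[h hP]].
    exists (cone_homotopy_new K).
    case=> [|n] [a b] /=.
      rewrite linear0 add0r (K0 b) linear0 subr0.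
      by congr (_, _); rewrite /= scaler0.
    by rewrite linear0 subr0; congr (_, _); rewrite /= ?addr0 // addrC subrK.
  exists (cone_homotopy_old h).
  case=> [|n] [a b] /=.
    rewrite (K0 b) linear0 add0r; congr (_, _); rewrite -?hP /=.
      by rewrite (K0 (h _ _)) linear0 add0r.
    by rewrite [RHS]K0 [LHS]K0.
  congr (_, _) => /=; first exact: hP.
  rewrite -hP linearN linearB linearZ /= opprK opprB addrAC addrC.
  by rewrite [x *: _ + _]addrC subrK.
- by case=> // n n_gt [a b]; rewrite [a]K_last 1?[b]K_last // ltnW.
pose t' : {linear cone K x (size (x :: xs)).+1 -> M} := t \o snd.
exists t'; split=> [m|[a b]].
  by have [b <-] := t_surj m; exists (0, b).
exists (t a), (t (cpx_d K _ (- b))); split=> //=.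
by rewrite linearB linearZ /= linearN linearN.
Qed.

Lemma koszul_like_exists xs (M : lmodType R) :
  C M -> exists K, koszul_like xs M K.
Proof.
move=> CM; elim: xs => [|x xs [K KP]]; last first.
  by exists (cone K x); apply: koszul_like_cone.
have Z0 (z : 'rV[R]_0) : z = 0 by apply/rowP => -[].
exists (@Complex (fun n => if n is 1%N then M else 'rV[R]_0)
  (fun n => hom0 _ _)).
split=> //.
- by case=> [|[|n]] //=; apply: C0 => z; apply: Z0.
- by case=> [|[|n]] //= _ z; apply: Z0.
- by exists idfun; split=> // m; exists m.
Qed.

(** Koszul cohomology is killed by [xs], by the homotopies.  In a degree where
    it vanishes, the cokernel of the incoming differential embeds into the next
    term, so the cokernel of this embedding is in the class; the next cohomology
    module lies in it and is killed by [xs], hence vanishes too. *)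
Lemma koszul_exact xs (M : lmodType R) (K : complex) n (z : K n.+1) :
    (forall (N : lmodType R) (m : N), C N ->
      (forall x, x \in xs -> x *: m = 0) -> m = 0) ->
    koszul_like xs M K -> cpx_d K n.+1 z = 0 -> exists y, cpx_d K n y = z.
Proof.
move=> C_kill [K0 dK CK hK _ _].
(* d_k factors as a surjection onto L, with L in the class, followed by an
   injection: this encodes exactness at the term k *)
pose splits k := exists (L : lmodType R) (p : {linear K k -> L})
    (i : {linear L -> K k.+1}), [/\ C L, forall l, exists a, p a = l,
  forall l, i l = 0 -> l = 0 & forall a, i (p a) = cpx_d K k a].
have step k : splits k -> splits k.+1 /\
    forall z, cpx_d K k.+1 z = 0 -> exists y, cpx_d K k y = z.
  move=> [L [p [i [CL p_surj i_inj ip]]]].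
  have [|L' [p' [p'_surj p'P]]] :=
      @quotient_module _ (K k.+1) [set a | exists y, cpx_d K k y = a].
    split=> [|a _ _ [y <-] [y' <-]]; first by exists 0; rewrite linear0.
    by exists (a *: y + y'); rewrite linearP.
  have [|i' i'P] := factor_through_surj (p := p') (f := cpx_d K k.+1) p'_surj.
    by move=> _ /p'P[y <-].
  have CL' : C L'.
    apply: (C_coker i_inj p'_surj _ CL (CK k.+1)) => b; rewrite p'P.
    split=> [[y <-]|[l <-]]; first by exists (p y).
    by have [y <-] := p_surj l; exists y; rewrite ip.
  have i'_inj l : i' l = 0 -> l = 0.
    have [a <-] := p'_surj l; rewrite i'P => da.
    apply: C_kill CL' _ => x /hK[h hP]; rewrite -linearZ /=; apply/p'P.
    by exists (h k a); rewrite -[RHS]hP da linear0 addr0.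
  split=> [|a da]; first by exists L', p', i'.
  by apply/p'P/i'_inj; rewrite i'P.
suff all_split k : splits k by have [_] := step n (all_split n); apply.
elim: k => [|k /step[]//].
exists (K 0%N), idfun, (cpx_d K 0%N); split=> // l; by exists l.
Qed.

(** Exactness of the Koszul complex at its last nonzero term. *)
Lemma ideal_mul_full xs (M : lmodType R) :
    (forall (N : lmodType R) (m : N), C N ->
      (forall x, x \in xs -> x *: m = 0) -> m = 0) ->
  C M -> forall m : M, ideal_mul xs m.
Proof.
move=> C_kill CM m; have [K KP] := koszul_like_exists xs CM.
have [_ _ _ _ K_last [t [t_surj td]]] := KP.
have [a <-] := t_surj m.
have [|y <-] := koszul_exact (z := a) C_kill KP; last exact: td.
exact: K_last.
Qed.

End Koszul.

(** * Determinants: Nakayama's lemma and McCoy's theorem *)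

Section Determinants.
Variable R : comPzRingType.

Lemma ideal_mul_lin (M : lmodType R) n (g : 'I_n -> M) (J : set R) xs (m : M) :
    @is_submod _ R^o J -> (forall x, x \in xs -> J x) ->
    (forall m, exists c, span_map g c = m) -> ideal_mul xs m ->
  exists c : 'rV[R]_n, (forall i, J (c 0 i)) /\ span_map g c = m.
Proof.
move=> [J0 JL] + g_gen; elim: xs m => [|x xs IHxs] m Jxs.
  by move=> /= ->; exists 0; split=> [i|]; rewrite ?mxE ?linear0.
move=> /= [a [b [/IHxs bP ->]]]; have [|c [Jc <-]] := bP.
  by move=> y yxs; apply: Jxs; rewrite in_cons yxs orbT.
have [d <-] := g_gen a; exists (x *: d + c); rewrite linearP; split=> // i.
by rewrite !mxE mulrC; apply: JL => //; apply: Jxs; rewrite mem_head.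
Qed.

(** Cramer's rule: det B is the product of the adjugate with B. *)
Lemma det_scale_submod (M : lmodType R) (D : set M) n (g : 'I_n -> M)
    (B : 'M[R]_n) : is_submod D ->
  (forall i, D (span_map g (row i B))) -> forall j, D (\det B *: g j).
Proof.
move=> D_sub Bg j.
have -> : \det B *: g j = \sum_k (\adj B *m B) j k *: g k.
  rewrite mul_adj_mx (bigD1 j) //= mxE eqxx mulr1n big1 ?addr0 //.
  by move=> k /negPf kj; rewrite mxE eq_sym kj scale0r.
under eq_bigr do rewrite mxE scaler_suml.
rewrite exchange_big /=.
under eq_bigr do under eq_bigr do rewrite -scalerA.
under eq_bigr do rewrite -scaler_sumr.
apply: is_submod_sum => // i.
have <- : span_map g (row i B) = \sum_k B i k *: g k; last exact: Bg.
by apply: eq_bigr => k _; rewrite mxE.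
Qed.

Lemma is_submod0 (M : lmodType R) : is_submod [set 0 : M].
Proof. by split=> // a x y -> ->; rewrite scaler0 addr0. Qed.

(** The matrix B writes the generators in terms of themselves with coefficients
    in J, so det (1 - B), which is congruent to 1 modulo J, kills M. *)
Lemma nakayama (M : lmodType R) (J : set R) xs :
    fin_gen M -> @is_submod _ R^o J -> (forall x, x \in xs -> J x) ->
    (forall m : M, ideal_mul xs m) ->
  exists a, J a /\ forall m : M, (1 - a) *: m = 0.
Proof.
move=> /fin_genP[n [g gP]] Jsub Jxs xsM.
have /choice[B BP] i := ideal_mul_lin Jsub Jxs gP (xsM (g i)).
have [J0 JL] := Jsub.
pose B' := 1%:M - \matrix_(i, j) B i 0 j.
have B'g i : span_map g (row i B') = 0.
  rewrite /span_map /= /span_fun.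
  under eq_bigr do rewrite !mxE scalerBl.
  rewrite sumrB; apply/eqP; rewrite subr_eq0; apply/eqP.
  have [_ Bi] := BP i; rewrite [RHS]Bi (bigD1 i) //=.
  rewrite eqxx mulr1n scale1r big1 ?addr0 //.
  by move=> j /negPf ji; rewrite eq_sym ji scale0r.
have JD x y : J x -> J y -> J (x + y).
  by move=> Jx Jy; rewrite -[x]mul1r; apply: JL.
have JM a x : J x -> J (a * x).
  by move=> Jx; rewrite -[_ * _]addr0; apply: JL.
(* congruence modulo J, carried through the Leibniz formula *)
pose E x y := J (x - y).
have ED x x' y y' : E x x' -> E y y' -> E (x + y) (x' + y').
  by rewrite /E opprD addrACA; apply: JD.
have EM x x' y y' : E x x' -> E y y' -> E (x * y) (x' * y').
  rewrite /E => Jx Jy; have -> : x * y - x' * y' = y * (x - x') + x' * (y - y').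
    by rewrite !mulrBr addrA [y * x']mulrC subrK [y * x]mulrC.
  by apply: JD; apply: JM.
have ER x : E x x by rewrite /E subrr.
have detE : E 1 (\det B').
  rewrite -(det1 R n); apply: (big_ind2 E (ER 0) ED) => s _.
  apply: (EM) (ER _) _; apply: (big_ind2 E (ER 1) EM) => i _.
  by rewrite !mxE /E subKr; have [] := BP i.
exists (1 - \det B'); split=> // m; have [c <-] := gP m.
rewrite subKr linear_sum; apply: big1 => i _ /=.
have /= B'gi := det_scale_submod (@is_submod0 M) B'g i.
by rewrite scalerA mulrC -scalerA B'gi scaler0.
Qed.

(** McCoy's argument: take a minor of maximal size t < n, with rows in Rel and
    columns given by f, that does not kill m.  Adding any column j outside the
    image of f and a further row, the cofactors along that row are the
    coefficients of the solution: against a row of Rel they give a minor of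
    size t + 1, which kills m, and the coefficient at j is the minor itself. *)
Lemma mccoy (M : lmodType R) n (Rel : set 'rV[R]_n) (m : M) :
    m != 0 ->
    (forall B : 'M[R]_n, (forall i, Rel (row i B)) -> \det B *: m = 0) ->
  exists v : 'I_n -> M, (exists i, v i != 0) /\
    forall r, Rel r -> span_map v r = 0.
Proof.
move=> m0 Bm.
pose minor t (rho : 'I_t -> 'rV[R]_n) (f : 'I_t -> 'I_n) :=
  \det (\matrix_(a, b) rho a 0 (f b)).
pose good t := exists (rho : 'I_t -> 'rV[R]_n) f,
  (forall a, Rel (rho a)) /\ minor t rho f *: m != 0.
have good0 : good 0%N.
  exists (fun=> 0), (fun i : 'I_0 => False_rect 'I_n (notF (ltn_ord i))).
  by split=> [[]//|]; rewrite /minor det_mx00 scale1r.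
have bad_n : ~ good n.
  move=> [rho [f [Rrho]]]; rewrite /minor.
  have -> : \matrix_(a, b) rho a 0 (f b) =
      (\matrix_a rho a) *m (\matrix_(i, b) (i == f b)%:R).
    apply/matrixP => a b; rewrite !mxE (bigD1 (f b)) //= !mxE eqxx mulr1.
    by rewrite big1 ?addr0 // => i /negPf fi; rewrite !mxE fi mulr0.
  rewrite det_mulmx mulrC -scalerA Bm ?scaler0 ?eqxx // => i.
  by rewrite rowK.
have [t [t_lt [rho [f [Rrho rho_m]]] bad]] :
    exists t, [/\ (t < n)%N, good t & ~ good t.+1].
  apply: contrapT => /forallNP no.
  suff all_good t : (t <= n)%N -> good t by apply/bad_n/all_good.
  elim: t => // t IHt t_lt; apply: contrapT => bad.
  by apply: (no t); split=> //; apply/IHt/ltnW.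
have [j jf] : exists j, forall a, f a != j.
  apply: contrapT => /forallNP no.
  have /choice[g fg] i : exists a, f a = i.
    by have /existsNP[a /negP] := no i; rewrite negbK => /eqP; exists a.
  have := leq_card g (can_inj fg).
  by rewrite !card_ord leqNgt t_lt.
pose f' (b : 'I_t.+1) := if unlift ord0 b is Some b' then f b' else j.
pose ext (r : 'rV[R]_n) : 'M[R]_t.+1 :=
  \matrix_(a, b) (if unlift ord0 a is Some a' then rho a' else r) 0 (f' b).
pose v i := \sum_(b | f' b == i) cofactor (ext 0) ord0 b *: m.
have cof r b : cofactor (ext r) ord0 b = cofactor (ext 0) ord0 b.
  rewrite /cofactor; congr (_ * \det _); apply/matrixP => a c.
  by rewrite !mxE liftK.
exists v; split=> [|r Rr].
  exists j; rewrite /v (bigD1 ord0) /=; last by rewrite /f' unlift_none.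
  rewrite big1 ?addr0 => [|b /andP[]]; last first.
    rewrite /f'; case: unliftP => [b' _|-> _]; last by rewrite eqxx.
    by rewrite (negPf (jf b')).
  suff -> : cofactor (ext 0) ord0 ord0 = minor t rho f by [].
  rewrite /cofactor addn0 expr0 mul1r; congr (\det _); apply/matrixP => a b.
  by rewrite !mxE liftK /f' liftK.
have -> : span_map v r = \det (ext r) *: m.
  rewrite (expand_det_row _ ord0) scaler_suml /span_map /= /span_fun.
  rewrite [RHS](partition_big f' predT) //=; apply: eq_bigr => i _.
  rewrite scaler_sumr; apply: eq_bigr => b /eqP <-.
  by rewrite cof mxE unlift_none scalerA.
apply/eqP/negPn/negP => ext_m; apply: bad.
exists (fun a => if unlift ord0 a is Some a' then rho a' else r), f'.
by split=> // a; case: unlift.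
Qed.

End Determinants.

(** * The annihilator of a totally self-reflexive module *)

Section Annihilator.
Variables (R : comPzRingType) (A : lmodType R).
Hypotheses (R_noeth : noetherian R) (A_fin_gen : fin_gen A).
Hypothesis A_reflexive : totally_reflexive A A.

Let E : lmodType R := {linear A -> A}.
Let u : E := idfun.

Let homothetyE (r : R) : homothety A r = r *: u.
Proof. by apply: linear_ext => x. Qed.

(** The biduality map is a section of evaluation at the identity, so when the
    former is bijective, so is the latter. *)
Lemma cone_orthogonal_self (P : proj_resolution E) : cone_orthogonal u P A.
Proof.
have [_ [bid bidK bidK'] A_ext] := A_reflexive.
split=> [i f f_coc|m|f fu].
- by have [_ /(_ P f f_coc)] := A_ext i.+1 isT.
- by exists (biduality A m).
suff -> : f = hom0 _ _ by [].
have bf0 : bid f = 0 by move: fu; rewrite -{1}(bidK' f).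
by rewrite -(bidK' f) bf0 linear0.
Qed.

Variable P : proj_resolution E.

(** By the exactness of the Koszul complex on generators of J, J A = A. *)
Lemma ideal_unit (J : set R) : @is_submod _ R^o J ->
    (forall (N : lmodType R) (m : N), cone_orthogonal u P N ->
      (forall x, J x -> x *: m = 0) -> m = 0) ->
  exists a, J a /\ forall x : A, (1 - a) *: x = 0.
Proof.
move=> J_sub J_kill.
have [k [g [Jg gP]]] := noetherian_regular R_noeth J_sub.
apply: (nakayama (xs := codom g)) => //; first by move=> _ /codomP[i ->].
apply: (ideal_mul_full (C := cone_orthogonal u P)).
- exact: cone_orthogonal0.
- exact: cone_orthogonal_prod.
- exact: cone_orthogonal_coker.
- move=> N m CN gm; apply: J_kill CN _ => x /gP[c <-].
  rewrite /span_map /= /span_fun scaler_suml big1 // => i _.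
  by rewrite -scalerA gm ?codom_f // scaler0.
exact: cone_orthogonal_self.
Qed.

(** The ideal J of all x with x E contained in R u is the annihilator of the
    cokernel C of the homothety map, and Hom(C, N) = 0 for N orthogonal; so J
    kills no nonzero element of N.  A map from C is represented by a map phi
    from E that vanishes at u. *)
Lemma homothety_surj (h : E) : exists r : R, h = r *: u.
Proof.
pose J : set R := [set x | forall h : E, exists r : R, x *: h = r *: u].
pose D : set E := [set h | exists r : R, h = r *: u].
have D_sub : is_submod D.
  split=> [|a _ _ [r ->] [s ->]]; first by exists 0; rewrite scale0r.
  by exists (a * r + s); rewrite scalerDl scalerA.
have J_sub : @is_submod _ R^o J.
  split=> [k|a x y Jx Jy k]; first by exists 0; rewrite !scale0r.
  have [[r xr] [s ys]] := (Jx k, Jy k).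
  by exists (a * r + s); rewrite !scalerDl -!scalerA xr ys.
have [N m CN Jm|a [Ja a1]] := ideal_unit J_sub; last first.
  have [r hr] := Ja h; exists r; rewrite -hr; apply: linear_ext => x.
  by apply/eqP; rewrite -subr_eq0 /= /homZ_fun -{1}[h x]scale1r -scalerBl a1.
have [_ _ N3] := CN; apply: contrapT => /eqP m0.
have /fin_genP[n [e eP]] := fin_gen_hom R_noeth A_fin_gen A_fin_gen.
have [B BD|v [[i vi0] vP]] := mccoy (Rel := [set r | D (span_map e r)]) m0.
  apply: Jm => k; have [c <-] := eP k.
  suff : D (\det B *: span_map e c) by [].
  rewrite /span_map /= /span_fun scaler_sumr.
  under eq_bigr do rewrite scalerA mulrC -scalerA.
  apply: is_submod_sum => // j; exact: det_scale_submod.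
have [|phi phiP] := factor_through_surj (p := span_map e) (f := span_map v) eP.
  by move=> r er; apply: vP; exists 0; rewrite er scale0r.
have phiu : phi u = 0.
  have [r ru] := eP u; rewrite -ru phiP; apply: vP; exists 1.
  by rewrite ru scale1r.
by move: vi0; rewrite -(span_delta v) -phiP N3 ?eqxx.
Qed.

Let I : set R := [set r | forall x : A, r *: x = 0].

Let annP r : I r -> r *: u = 0.
Proof. by move=> Ir; apply: linear_ext => x; exact: Ir. Qed.

Let ann_sub : @is_submod _ R^o I.
Proof.
split=> [x|a r s Ir Is x]; first by rewrite scale0r.
by rewrite scalerDl -scalerA Ir Is scaler0 addr0.
Qed.

(** Once the homothety map is onto, E is R / I; for N orthogonal, I N = 0 and
    Ext^1(R / I, N) = 0, so every map from I to N extends to R and then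
    vanishes.  The map from I to N given by the tuple v is only used after
    composition with d_0, as a 1-cochain of the resolution. *)
Lemma ann_orthogonal (N : lmodType R) n (g : 'I_n -> R^o) (v : 'I_n -> N) :
    (forall i, I (g i)) -> (forall r, I r -> exists c, span_map g c = r) ->
    (forall c, span_map g c = 0 -> span_map v c = 0) ->
  cone_orthogonal u P N -> forall i, v i = 0.
Proof.
move=> Ig gP vP [N1 N2 _] i.
have IN r (m : N) : I r -> r *: m = 0.
  by move=> /annP ru; have [f <-] := N2 m; rewrite -linearZ ru linear0.
have [c0 c0u] := res_aug_surj P u.
have hom_surj (k : E) : exists r : R^o, homothety A r = k.
  by have [r ->] := homothety_surj k; exists r; rewrite homothetyE.
(* s lifts the augmentation along R -> E; its restriction to the boundaries
   has values in I *)
have [s sP] := @res_proj _ _ P 0%N _ _ (@homothety R A : {linear R^o -> E})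
  (res_aug P) hom_surj.
have Iker r : homothety A r = 0 -> I r.
  by move=> r0 x; have := congr1 (fun f : E => f x) r0.
have Isd y : I (s (res_diff P 0 y)) by apply: Iker; rewrite [LHS]sP res_augK.
have [|m|a y m y' m'|f fP] := @linear_of_rel _ (P 1%N) N
    (fun y m => exists c,
       span_map g c = s (res_diff P 0 y) /\ span_map v c = m).
- by move=> y; have [c cP] := gP _ (Isd y); exists (span_map v c), c.
- by move=> [c [gc <-]]; apply: vP; rewrite gc !linear0.
- move=> [c [gc <-]] [c' [gc' <-]]; exists (a *: c + c').
  by rewrite !linearP gc gc'.
have [|k kP] := N1 0%N f.
  move=> y; have [c [gc <-]] := fP (res_diff P 1 y); apply: vP.
  by rewrite gc res_diffK linear0.
(* by IN, the extension k of f vanishes on g_i c0, which is a boundary because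
   g_i kills E; there f takes the value s(c0) v_i, that is, v_i *)
have [z zP] : exists z, res_diff P 0 z = (g i : R) *: c0.
  by apply/res_exact0; rewrite linearZ /= c0u; apply: annP.
have [c [gc vc]] := fP z.
have span_sc (M : lmodType R) (w : 'I_n -> M) :
    span_map w ((s c0 : R) *: delta_mx 0 i) = (s c0 : R) *: w i.
  by rewrite linearZ /= span_delta.
have : span_map v (c - (s c0 : R) *: delta_mx 0 i) = 0.
  apply: vP; rewrite linearB gc zP span_sc linearZ.
  by rewrite /GRing.scale /= mulrC subrr.
rewrite linearB vc kP zP linearZ /= IN // span_sc sub0r.
move/eqP; rewrite oppr_eq0 => /eqP sv.
have : I (s c0 - 1).
  apply: Iker; rewrite linearB /= [X in X - _]sP c0u homothetyE.
  by rewrite scale1r subrr.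
move=> /(IN _ (v i)); rewrite scalerBl sv scale1r sub0r => /eqP.
by rewrite oppr_eq0 => /eqP.
Qed.

(** The annihilator J of I kills no nonzero element of an orthogonal module, as
    Hom(I, N) = 0; so 1 = a + (1 - a) with a in Ann(I) and 1 - a in I. *)
Lemma ann_idempotent : exists e : R, [/\ e * e = e,
  forall x : A, e *: x = 0 & forall r, (forall x : A, r *: x = 0) -> r = e * r].
Proof.
have [n [g [Ig gP]]] := noetherian_regular R_noeth ann_sub.
pose J : set R := [set x | forall r, I r -> x * r = 0].
have J_sub : @is_submod _ R^o J.
  split=> [r _|a x y Jx Jy r Ir]; first by rewrite mul0r.
  by rewrite mulrDl -mulrA Jx ?Jy // mulr0 addr0.
have [N m CN Jm|a [Ja Ia]] := ideal_unit J_sub; last first.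
  have eI r : I r -> r = (1 - a) * r.
    by move=> Ir; rewrite mulrBl mul1r Ja ?subr0.
  by exists (1 - a); split=> //; rewrite -eI.
apply: contrapT => /eqP m0.
have [B BD|v [[i vi0] vP]] := mccoy (Rel := [set r | span_map g r = 0]) m0.
  apply: Jm => r Ir; have [c <-] := gP r Ir.
  rewrite /span_map /= /span_fun mulr_sumr big1 // => i _.
  have /= := det_scale_submod (g := g) (B := B) (@is_submod0 _ R^o).
  by rewrite /GRing.scale /= mulrCA => -> //; rewrite mulr0.
by move: vi0; rewrite (ann_orthogonal Ig gP _ CN) ?eqxx.
Qed.

End Annihilator.

(** * Corner rings and corner modules of an idempotent *)

Section Corner.
Variables (R : comNzRingType) (e : R).
Hypotheses (ee : e * e = e) (e_neq0 : e != 0).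

(** The proofs are parameters of the type because the ring structure, whose
    unit is [e], is attached to the type and depends on them. *)
Record corner (ee' : e * e = e) (e_neq0' : e != 0) :=
  Corner { corner_val : R; corner_valP : e * corner_val == corner_val }.
Local Notation S := (corner ee e_neq0).

HB.instance Definition _ := [isSub of S for @corner_val ee e_neq0].
HB.instance Definition _ := [Choice of S by <:].

Fact corner_proj_subproof (x : R) : e * (e * x) == e * x.
Proof. by rewrite mulrA ee. Qed.

Definition corner_proj (x : R) : S := Corner ee e_neq0 (corner_proj_subproof x).

Lemma corner_mul1 (x : S) : e * val x = val x.
Proof. exact/eqP/corner_valP. Qed.

Lemma corner_projK (x : S) : corner_proj (val x) = x.
Proof. by apply: val_inj; rewrite /= corner_mul1. Qed.

Definition corner_add (x y : S) : S := corner_proj (val x + val y).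
Definition corner_opp (x : S) : S := corner_proj (- val x).
Definition corner_mul (x y : S) : S := corner_proj (val x * val y).

Fact corner_addA : associative corner_add.
Proof.
by move=> x y z; apply: val_inj; rewrite /= !mulrDr !mulrA !ee addrA.
Qed.
Fact corner_addC : commutative corner_add.
Proof. by move=> x y; apply: val_inj; rewrite /= addrC. Qed.
Fact corner_add0 : left_id (corner_proj 0) corner_add.
Proof. by move=> x; apply: val_inj; rewrite /= mulr0 add0r corner_mul1. Qed.
Fact corner_addN : left_inverse (corner_proj 0) corner_opp corner_add.
Proof. by move=> x; apply: val_inj; rewrite /= mulrN corner_mul1 addNr. Qed.
HB.instance Definition _ :=
  GRing.isZmodule.Build S corner_addA corner_addC corner_add0 corner_addN.

Fact corner_mulA : associative corner_mul.
Proof.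
move=> x y z; apply: val_inj => /=.
by rewrite !mulrA ee [e * _ * e]mulrC !mulrA ee.
Qed.
Fact corner_mulC : commutative corner_mul.
Proof. by move=> x y; apply: val_inj; rewrite /= [val x * _]mulrC. Qed.
Fact corner_mul1l : left_id (corner_proj 1) corner_mul.
Proof. by move=> x; apply: val_inj; rewrite /= mulr1 !corner_mul1. Qed.
Fact corner_mulDl : left_distributive corner_mul +%R.
Proof.
by move=> x y z; apply: val_inj; rewrite /= -mulrDr -mulrDl !mulrA ee.
Qed.
Fact corner_1neq0 : corner_proj 1 != 0 :> S.
Proof. by rewrite -val_eqE /= mulr1 mulr0. Qed.
HB.instance Definition _ := GRing.Zmodule_isComNzRing.Build S
  corner_mulA corner_mulC corner_mul1l corner_mulDl corner_1neq0.

Lemma corner_valD (x y : S) : val (x + y) = val x + val y.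
Proof. by rewrite /= mulrDr !corner_mul1. Qed.
Lemma corner_valM (x y : S) : val (x * y) = val x * val y.
Proof. by rewrite /= mulrA corner_mul1. Qed.

Fact corner_proj_zmod : zmod_morphism corner_proj.
Proof.
move=> x y; apply: val_inj.
by rewrite corner_valD /= !(mulrBr, mulrN) mulrA ee.
Qed.
Fact corner_proj_monoid : monoid_morphism corner_proj.
Proof.
by split=> // x y; apply: val_inj; rewrite corner_valM /= mulrACA ee.
Qed.
HB.instance Definition _ :=
  GRing.isZmodMorphism.Build R S corner_proj corner_proj_zmod.
HB.instance Definition _ :=
  GRing.isMonoidMorphism.Build R S corner_proj corner_proj_monoid.

Lemma corner_proj_idem : corner_proj e = 1.
Proof. by apply: val_inj; rewrite /= ee mulr1. Qed.

Lemma corner_noetherian : noetherian R -> noetherian S.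
Proof.
move=> R_noeth I [I0 IL].
have [|n [g [Ig gP]]] := R_noeth (fun x => corner_proj x \in I).
  split=> [|a x y Ix Iy]; rewrite ?inE /in_mem /= ?rmorph0 //.
  by rewrite rmorphD rmorphM; apply: IL.
exists n, (corner_proj \o g); split=> // x Ix.
have [|c cP] := gP (val x); first by rewrite /in_mem /= corner_projK.
exists (corner_proj \o c); rewrite -[LHS]corner_projK cP rmorph_sum.
by apply: eq_bigr => i _; rewrite /= rmorphM.
Qed.

Section CornerModule.
Variable M : lmodType R.

Record corner_module := CornerElt {
  corner_elt : M;
  corner_eltP : e *: corner_elt == corner_elt
}.
HB.instance Definition _ := [isSub of corner_module for corner_elt].
HB.instance Definition _ := [Choice of corner_module by <:].

Fact corner_part_subproof (x : M) : e *: (e *: x) == e *: x.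
Proof. by rewrite scalerA ee. Qed.

Definition corner_part (x : M) : corner_module :=
  CornerElt (corner_part_subproof x).

Lemma corner_scale1 (x : corner_module) : e *: val x = val x.
Proof. exact/eqP/corner_eltP. Qed.

Lemma corner_partK (x : corner_module) : corner_part (val x) = x.
Proof. by apply: val_inj; rewrite /= corner_scale1. Qed.

Definition cmod_add (x y : corner_module) := corner_part (val x + val y).
Definition cmod_opp (x : corner_module) := corner_part (- val x).
Definition cmod_scale (a : S) (x : corner_module) :=
  corner_part (val a *: val x).

Fact cmod_addA : associative cmod_add.
Proof.
by move=> x y z; apply: val_inj; rewrite /= !scalerDr !scalerA !ee addrA.
Qed.
Fact cmod_addC : commutative cmod_add.
Proof. by move=> x y; apply: val_inj; rewrite /= addrC. Qed.
Fact cmod_add0 : left_id (corner_part 0) cmod_add.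
Proof. by move=> x; apply: val_inj; rewrite /= scaler0 add0r corner_scale1. Qed.
Fact cmod_addN : left_inverse (corner_part 0) cmod_opp cmod_add.
Proof. by move=> x; apply: val_inj; rewrite /= scalerN corner_scale1 addNr. Qed.
HB.instance Definition _ :=
  GRing.isZmodule.Build corner_module cmod_addA cmod_addC cmod_add0 cmod_addN.

Lemma cmod_valD (x y : corner_module) : val (x + y) = val x + val y.
Proof. by rewrite /= scalerDr !corner_scale1. Qed.

Let val_scale (a : S) (x : corner_module) :
  val (cmod_scale a x) = val a *: val x.
Proof. by rewrite /= scalerA corner_mul1. Qed.

Fact cmod_scaleA a b x : cmod_scale a (cmod_scale b x) = cmod_scale (a * b) x.
Proof. by apply: val_inj; rewrite !val_scale corner_valM scalerA. Qed.
Fact cmod_scale1 : left_id 1 cmod_scale.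
Proof.
by move=> x; apply: val_inj; rewrite val_scale /= mulr1 corner_scale1.
Qed.
Fact cmod_scaleDr : right_distributive cmod_scale +%R.
Proof.
by move=> a x y; apply: val_inj; rewrite !(val_scale, cmod_valD) scalerDr.
Qed.
Fact cmod_scaleDl x : {morph cmod_scale^~ x : a b / a + b}.
Proof.
move=> a b; apply: val_inj.
by rewrite !(val_scale, cmod_valD) corner_valD scalerDl.
Qed.
HB.instance Definition _ := GRing.Zmodule_isLmodule.Build S corner_module
  cmod_scaleA cmod_scale1 cmod_scaleDr cmod_scaleDl.

Lemma cmod_valZ (a : S) (x : corner_module) : val (a *: x) = val a *: val x.
Proof. exact: val_scale. Qed.

Lemma cmod_val0 : val (0 : corner_module) = 0.
Proof. exact: scaler0. Qed.

Lemma corner_partD x y : corner_part (x + y) = corner_part x + corner_part y.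
Proof. by apply: val_inj; rewrite cmod_valD /= scalerDr. Qed.

Lemma corner_partZ a x : corner_part (a *: x) = corner_proj a *: corner_part x.
Proof.
apply: val_inj; rewrite cmod_valZ /= !scalerA.
by rewrite -mulrA [e * (a * e)]mulrCA ee mulrC.
Qed.

End CornerModule.

(** Over R, a module X over the corner ring maps to N through the corner of N:
    restriction of scalars is left adjoint to taking the corner module. *)
Section Adjunction.
Variables (X : lmodType S) (N : lmodType R).
Local Notation resX := (restrict_scalars corner_proj X).

Lemma res_scaleE (a : R) (x : resX) : a *: x = corner_proj a *: (x : X) :> X.
Proof. by []. Qed.

Lemma res_hom_fixed (f : {linear resX -> N}) (x : X) : e *: f x = f x.
Proof.
by rewrite -linearZ /= res_scaleE corner_proj_idem scale1r.
Qed.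

Fact to_corner_linear (f : {linear resX -> N}) :
  linear (fun x : X => corner_part (f x)).
Proof.
move=> a x y; rewrite -{1}[a]corner_projK -res_scaleE.
rewrite [X in corner_part X](linearP f) corner_partD corner_partZ.
by rewrite corner_projK.
Qed.
Definition to_corner f : {linear X -> corner_module N} :=
  mk_linear (to_corner_linear f).

Fact of_corner_linear (f : {linear X -> corner_module N}) :
  linear (fun x : resX => val (f x)).
Proof.
move=> a x y; rewrite res_scaleE linearP cmod_valD cmod_valZ /=.
by rewrite mulrC -scalerA corner_scale1.
Qed.
Definition of_corner f : {linear resX -> N} := mk_linear (of_corner_linear f).

Lemma val_to_corner f x : val (to_corner f x) = f x.
Proof. exact: res_hom_fixed. Qed.

End Adjunction.

(** The corner of a surjection is a surjection, and lifting through it is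
    lifting through the original one, by adjunction. *)
Lemma restrict_projective (X : lmodType S) :
  projective X -> projective (restrict_scalars corner_proj X).
Proof.
move=> X_proj M N p f p_surj.
have p'_linear : linear (fun x : corner_module M => corner_part (p (val x))).
  move=> a x y; rewrite cmod_valD cmod_valZ linearP corner_partD corner_partZ.
  by rewrite corner_projK.
have [y|g gP] := X_proj _ _ (mk_linear p'_linear) (to_corner f).
  have [x px] := p_surj (val y); exists (corner_part x) => /=.
  by rewrite linearZ /= px corner_scale1 corner_partK.
exists (of_corner g) => x; have /(congr1 val) := gP x.
by rewrite val_to_corner /= -linearZ corner_scale1.
Qed.

Fact restrict_hom_linear (X Y : lmodType S) (f : {linear X -> Y}) :
  linear (f : restrict_scalars corner_proj X -> restrict_scalars corner_proj Y).
Proof. by move=> a x y; exact: linearP. Qed.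
Definition restrict_hom (X Y : lmodType S) (f : {linear X -> Y}) :=
  mk_linear (@restrict_hom_linear X Y f).

Section SemidualizingCorner.
Variable A : lmodType R.
Hypothesis A_fixed : forall x : A, e *: x = x.

Lemma val_corner_part (x : A) : val (corner_part x) = x.
Proof. exact: A_fixed. Qed.

(** A projective resolution over the corner ring is, by restriction of scalars,
    one over R, with the same cochains. *)
Lemma corner_Ext_vanishes i :
  Ext_vanishes i.+1 A A ->
  Ext_vanishes i.+1 (corner_module A : lmodType S) (corner_module A).
Proof.
move=> A_ext P f f_coc.
have aug_surj : forall y, exists x, of_corner (res_aug P) x = y.
  move=> y; have [x xy] := res_aug_surj P (corner_part y); exists x.
  by rewrite /= xy val_corner_part.
have exact0 x : of_corner (res_aug P) x = 0 <->
    exists y, restrict_hom (res_diff P 0) y = x.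
  split=> [x0|/res_exact0 /= ->]; last exact: cmod_val0.
  by apply/res_exact0/val_inj; rewrite cmod_val0.
have exactS n x : restrict_hom (res_diff P n) x = 0 <->
    exists y, restrict_hom (res_diff P n.+1) y = x by exact: res_exactS.
pose P' := ProjResolution (fun n => restrict_projective (@res_proj _ _ P n))
  aug_surj exact0 exactS.
have [x|g gP] := A_ext P' (of_corner f).
  by rewrite /= f_coc cmod_val0.
exists (to_corner g) => x; apply: val_inj.
by rewrite val_to_corner -gP.
Qed.

Lemma corner_fin_gen : fin_gen A -> fin_gen (corner_module A : lmodType S).
Proof.
move=> [n [g gP]]; exists n, (fun i => corner_part (g i)) => x.
have [c cP] := gP (val x); exists (corner_proj \o c).
rewrite -[LHS]corner_partK cP; elim/big_ind2: _ => [|y y' z z' <- <-|i _].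
- by [].
- by rewrite corner_partD.
- by rewrite corner_partZ.
Qed.

End SemidualizingCorner.

End Corner.

(** * Idempotents disconnect the spectrum *)

Section Spectrum.
Variable R : comNzRingType.

(** An ideal maximal among the proper ideals containing e, found by Zorn's
    lemma, is prime. *)
Lemma prime_containing (e : R) :
  (forall r, r * e != 1) -> exists p : Spec R, e \in prime_pred p.
Proof.
move=> e_nonunit.
pose proper (X : set R) := [/\ @is_submod _ R^o X, X e & ~ X 1].
(* the empty set is added because it is the union of the empty chain *)
have [|X [PX X_max]] := @Zorn_bigcup R (fun X => X = set0 \/ proper X).
  move=> F FP F_tot; have [F0|] := pselect (forall X, F X -> X = set0).
    by left; apply/seteqP; split=> // x [X /F0 ->].
  move=> /existsNP[X0 /not_implyP[FX0 X0_neq0]]; right.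
  have F_proper X x : F X -> X x -> proper X.
    by move=> FX Xx; have [X_eq0|//] := FP X FX; rewrite X_eq0 in Xx.
  have [[X00 _] X0e _] : proper X0 by have [] := FP X0 FX0.
  split=> [||[X FX X1]].
  - split=> [|a x y [X FX Xx] [Y FY Yy]]; first by exists X0.
    have [XY|YX] := F_tot X Y FX FY.
      exists Y => //; have [[_ YL] _ _] := F_proper Y y FY Yy.
      by apply: YL => //; apply: XY.
    exists X => //; have [[_ XL] _ _] := F_proper X x FX Xx.
    by apply: XL => //; apply: YX.
  - by exists X0.
  - by have [_ _] := F_proper X 1 FX X1.
have Pe : proper [set x | exists r, x = r * e].
  split=> [||[r /esym/eqP]]; last by apply/negP.
  - split=> [|a _ _ [r ->] [s ->]]; first by exists 0; rewrite mul0r.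
    by exists (a * r + s); rewrite mulrDl -mulrA.
  - by exists 1; rewrite mul1r.
have [X_eq0|[[X0 XL] Xe X1]] := PX.
  case: (X_max [set x | exists r, x = r * e]); last by right.
  rewrite X_eq0; split=> // /(_ e); apply.
  by have [] := Pe.
have XM a x : X x -> X (a * x) by move=> Xx; rewrite -[_ * _]addr0; apply: XL.
have X_prime u v : X (u * v) -> X u \/ X v.
  move=> Xuv; have [Xu|nXu] := pselect (X u); [by left | right].
  pose Y : set R := [set x | exists a r, X a /\ x = a + r * u].
  have XY : X `<=` Y by move=> x Xx; exists x, 0; rewrite mul0r addr0.
  have [[a [r [Xa a1]]]|Y1] := pselect (Y 1).
    rewrite -[v]mul1r a1 mulrDl -mulrA -[a]mul1r -mulrA.
    by apply: XL; [rewrite mulrC; apply: XM | apply: XM].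
  case: (X_max Y).
    by split=> // /(_ u) YX; apply/nXu/YX; exists 0, 1; rewrite mul1r add0r.
  right; split=> //; last exact: XY.
  split=> [|b _ _ [a [r [Xa ->]]] [c [s [Xc ->]]]]; first exact: XY.
  exists (b * a + c), (b * r + s); split; first exact: XL.
  by rewrite /GRing.scale /= mulrDr mulrDl mulrA addrACA.
have X_ideal : idealr_closed (fun x : R => `[< X x >]).
  split=> [||a x y /asboolP Xx /asboolP Xy]; first exact/asboolP.
    by apply/negP => /asboolP.
  exact/asboolP/XL.
have X_primed : prime_idealr_closed (fun x : R => `[< X x >]).
  by move=> u v /asboolP/X_prime[Xu|Xv]; apply/orP; [left|right]; apply/asboolP.
by exists (PrimeIdeal X_ideal X_primed); apply/asboolP.
Qed.

Lemma prime_subr1 (p : Spec R) (e : R) :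
  e \in prime_pred p -> 1 - e \in prime_pred p -> False.
Proof.
have [_ /negP p1 pL] := prime_ideal p => pe pe'; apply: p1.
by rewrite -[1](subrK e) -[1 - e]mul1r pL.
Qed.

(** The closed sets V(e) and V(1 - e) are complementary, and nonempty because
    neither idempotent is a unit. *)
Lemma spec_disconnected (e : R) :
  e * e = e -> e != 0 -> e != 1 -> ~ connected [set: Spec R].
Proof.
move=> ee e0 e1 R_conn.
have e'e' : (1 - e) * (1 - e) = 1 - e.
  by rewrite mulrBr mulr1 mulrBl mul1r ee subrr subr0.
have nonunit (f : R) : f * f = f -> f != 1 -> forall r, r * f != 1.
  move=> ff f1 r; apply: contraNneq f1 => rf.
  by rewrite -rf -{2}ff mulrA rf mul1r.
have [p pe] := prime_containing (nonunit e ee e1).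
have [|q qe'] := prime_containing (nonunit (1 - e) e'e' _).
  by apply: contra_neq e0 => e'1; rewrite -[e](subKr 1) e'1 subrr.
have VE : zero_locus [set e] = ~` zero_locus [set 1 - e].
  apply/seteqP; split=> r /= re.
    by move=> /(_ _ erefl); apply: prime_subr1; apply: re.
  move=> _ ->; apply: contrapT => /negP re'; apply: re => _ ->.
  have : e * (1 - e) \in prime_pred r.
    by rewrite mulrBr mulr1 ee subrr; have [] := prime_ideal r.
  by move=> /(prime_prime (s := r)); rewrite (negPf re').
have V_open E : open (~` zero_locus E : set (Spec R)) by exists E.
have : zero_locus [set e] = [set: Spec R].
  apply: R_conn; first by exists p => _ ->.
    by exists (zero_locus [set e]); rewrite ?setTI // VE.
  exists (zero_locus [set e]); rewrite ?setTI //.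
  by rewrite -[zero_locus _]setCK; apply: open_closedC.
move=> /seteqP[_ /(_ q I) /(_ e erefl)] qe.
exact: prime_subr1 qe qe'.
Qed.

End Spectrum.

(** * The decomposition *)

Lemma inj_surj_bijective (X Y : Type) (f : X -> Y) :
  injective f -> (forall y, exists x, f x = y) -> bijective f.
Proof.
by move=> f_inj /choice[g gK]; exists g => // x; apply: f_inj; rewrite gK.
Qed.

Section CornerSemidualizing.
Variables (R : comNzRingType) (e : R) (ee : e * e = e) (e_neq0 : e != 0).
Variable A : lmodType R.

(** Over the corner ring A is faithful, by the hypothesis on annihilators, and
    its endomorphisms are the R-linear ones, hence homotheties. *)
Lemma semidualizing_corner :
    fin_gen A -> (forall i, Ext_vanishes i.+1 A A) ->
    (forall x : A, e *: x = x) ->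
    (forall r, (forall x : A, r *: x = 0) -> e * r = 0) ->
    (forall h : {linear A -> A}, exists r, forall x, h x = r *: x) ->
  semidualizing (corner_module e A : lmodType (corner ee e_neq0)).
Proof.
move=> A_fin A_ext A_fixed ann_e hom_surj; split.
- exact: corner_fin_gen.
- apply: inj_surj_bijective => [a b ab|f].
    apply/val_inj/eqP; rewrite -subr_eq0 -(corner_mul1 a) -(corner_mul1 b).
    rewrite -mulrBr; apply/eqP/ann_e => x.
    rewrite scalerBl; apply/eqP; rewrite subr_eq0; apply/eqP.
    pose C : lmodType (corner ee e_neq0) := corner_module e A.
    pose c : C := corner_part ee x.
    have : val (a *: c) = val (b *: c).
      exact: (congr1 (fun f : {linear C -> C} => val (f c)) ab).
    by rewrite !cmod_valZ val_corner_part.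
  have f'_linear : linear (fun x : A => val (f (corner_part ee x))).
    move=> a x y; rewrite corner_partD (corner_partZ ee e_neq0) linearP.
    by rewrite cmod_valD cmod_valZ /= mulrC -scalerA A_fixed.
  have [r rP] := hom_surj (mk_linear f'_linear).
  exists (corner_proj ee e_neq0 r); apply: linear_ext => x; apply: val_inj.
  rewrite [LHS]cmod_valZ /= mulrC -scalerA A_fixed -[LHS]rP /=.
  by rewrite corner_partK.
- by case=> // i _; apply: corner_Ext_vanishes.
Qed.

End CornerSemidualizing.

Theorem theorem1p3 (R : comNzRingType) (A : lmodType R)
    (R_noetherian : noetherian R)
    (A_nonzero : exists x : A, x != 0)
    (A_fin_gen : fin_gen A)
    (A_reflexive : totally_reflexive A A)
    (A_not_semidualizing : ~ semidualizing A) :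
  (exists (R1 R2 : comNzRingType) (phi : {rmorphism R -> (R1 * R2)%type}),
     [/\ noetherian R1, noetherian R2, bijective phi
       & exists A1 : lmodType R1,
           semidualizing A1 /\
           lmod_iso A (restrict_scalars phi (prod_module A1 'rV[R2]_0))])
  /\ ~ connected [set: Spec R].
Proof.
have [_ _ A_ext] := A_reflexive.
have AA_ext i : Ext_vanishes i.+1 A A by have [] := A_ext i.+1 isT.
have [P _] := free_resolution R_noetherian
  (fin_gen_hom R_noetherian A_fin_gen A_fin_gen).
have hom_surj (h : {linear A -> A}) : exists r, forall x, h x = r *: x.
  have [r ->] := homothety_surj R_noetherian A_fin_gen A_reflexive P h.
  by exists r.
have [f [ff fA annf]] := ann_idempotent R_noetherian A_fin_gen A_reflexive P.
pose e := 1 - f.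
have ee : e * e = e by rewrite /e mulrBr mulr1 mulrBl mul1r ff subrr subr0.
have fe : f * e = 0 by rewrite /e mulrBr mulr1 ff subrr.
have e_fixed (x : A) : e *: x = x by rewrite scalerBl scale1r fA subr0.
have e_neq0 : e != 0.
  have [x x0] := A_nonzero; apply: contraNneq x0 => e0.
  by rewrite -(e_fixed x) e0 scale0r.
have f_neq0 : f != 0.
  apply/eqP => f0; apply: A_not_semidualizing; split=> //.
    apply: inj_surj_bijective => [a b ab|h].
      apply/eqP; rewrite -subr_eq0 (annf (a - b)) ?f0 ?mul0r // => x.
      have /= := congr1 (fun h : {linear A -> A} => h x) ab.
      by rewrite /homothety scalerBl => ->; rewrite subrr.
    by have [r rP] := hom_surj h; exists r; apply: linear_ext => x.
  by case.
have ann_e r : (forall x : A, r *: x = 0) -> e * r = 0.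
  by move=> /annf ->; rewrite mulrA [e * f]mulrC fe mul0r.
split; last first.
  apply: (@spec_disconnected R f) => //; apply: contraNneq e_neq0 => f1.
  by rewrite /e f1 subrr.
pose R1 : comNzRingType := corner ee e_neq0.
pose R2 : comNzRingType := corner ff f_neq0.
pose phi_fun (r : R) : R1 * R2 :=
  (corner_proj ee e_neq0 r, corner_proj ff f_neq0 r).
have phi_zmod : zmod_morphism phi_fun.
  by move=> a b; rewrite /phi_fun !rmorphB.
have phi_monoid : monoid_morphism phi_fun.
  by split=> [|a b]; rewrite /phi_fun ?rmorph1 ?rmorphM.
pose phi := HB.pack_for {rmorphism R -> (R1 * R2)%type} phi_fun
  (GRing.isZmodMorphism.Build R (R1 * R2)%type phi_fun phi_zmod)
  (GRing.isMonoidMorphism.Build R (R1 * R2)%type phi_fun phi_monoid).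
have ef1 r : e * r + f * r = r by rewrite -mulrDl subrK mul1r.
exists R1, R2, phi; split.
- exact: corner_noetherian.
- exact: corner_noetherian.
- apply: inj_surj_bijective => [a b|[a b]].
    by case=> ea fa; rewrite -(ef1 a) -(ef1 b) ea fa.
  exists (val a + val b); congr (_, _); apply: val_inj => /=.
    rewrite mulrDr corner_mul1 -(corner_mul1 b) mulrA [e * f]mulrC fe.
    by rewrite mul0r addr0.
  by rewrite mulrDr corner_mul1 -(corner_mul1 a) mulrA fe mul0r add0r.
exists (corner_module e A : lmodType R1); split.
  exact: semidualizing_corner.
have iso_linear : linear (fun x : A => (corner_part ee x, 0) :
    restrict_scalars phi
      (prod_module (corner_module e A : lmodType R1) 'rV[R2]_0)).
  move=> a x y; rewrite corner_partD (corner_partZ ee e_neq0).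
  by congr (_, _); apply/rowP => -[].
exists (mk_linear iso_linear).
apply: inj_surj_bijective => [x y []|[x y]].
  by rewrite !e_fixed.
by exists (val x); rewrite /= corner_partK; congr (_, _); apply/rowP => -[].
Qed.
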